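(* Let $r\ge 1$ and $X=\mathbb P^r$. Consider the following two families of equations satisfied by the correlation functions of the Gromov-Witten invariants of $\mathbb P^r$. (V) The Virasoro conditions: for all $k\ge 1$ and $g\ge 1$, $$\begin{aligned}0=&-\sum_{p=0}^{k+1}\Big[\tfrac{3-r}2\Big]^k_p(R^p)_0{}^b\,\langle\!\langle\tau_{k+1-p}(T_b)\rangle\!\rangle_g+\sum_{p=0}^{k+1}\sum_{m=0}^\infty\Big[a+m+\tfrac{1-r}2\Big]^k_p(R^p)_a{}^b\,t_m^a\,\langle\!\langle\tau_{k+m-p}(T_b)\rangle\!\rangle_g\\&+\tfrac12\sum_{p=0}^{k+1}\sum_{m=p-k}^{-1}(-1)^m\Big[a+m+\tfrac{1-r}2\Big]^k_p(R^p)_a{}^b\,\langle\!\langle\tau_{-m-1}(T^a)\,\tau_{k+m-p}(T_b)\rangle\!\rangle_{g-1}\\&+\tfrac12\sum_{p=0}^{k+1}\sum_{m=p-k}^{-1}\sum_{h=0}^g(-1)^m\Big[a+m+\tfrac{1-r}2\Big]^k_p(R^p)_a{}^b\,\langle\!\langle\tau_{-m-1}(T^a)\rangle\!\rangle_h\,\langle\!\langle\tau_{k+m-p}(T_b)\rangle\!\rangle_{g-h}.\end{aligned}$$ (T) The topological recursion relations: for all $g\ge 1$, $N\ge 3g-1$, $m\ge 0$ and $\gamma\in A^*(X)$, $$\langle\!\langle\tau_{N+m}(\gamma)\rangle\!\rangle_g=\sum_{i+j=N-1}\langle\!\langle\tau_m(\gamma)\,T_a\rangle\!\rangle^i\,\langle\!\langle\tau_j(T^a)\rangle\!\rangle_g,$$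 where $\langle\!\langle\cdots\rangle\!\rangle^0=\langle\!\langle\cdots\rangle\!\rangle_0$ and $\langle\!\langle\tau_m(\gamma_1)\gamma_2\rangle\!\rangle^i=\langle\!\langle\tau_{m+1}(\gamma_1)\gamma_2\rangle\!\rangle^{i-1}-\langle\!\langle\tau_m(\gamma_1)T_a\rangle\!\rangle_0\langle\!\langle T^a\gamma_2\rangle\!\rangle^{i-1}$ for $i\ge1$. Then (V) together with (T) give a constructive way to determine all Gromov-Witten invariants of $\mathbb P^r$. That is, starting from the genus-$0$ invariants, all invariants of genus $g\ge 1$ with $n\ge1$ marked points are determined by recursion over $g$ and, for fixed $g$, over $n$: for any fixed $g\ge1$, $n\ge1$, non-negative integers $m_2,\dots,m_n$ and $a_2,\dots,a_n\in\{0,\dots,r\}$, the invariants $\langle\tau_j(T_b)\tau_{m_2}(T_{a_2})\cdots\tau_{m_n}(T_{a_n})\rangle_{g,e}$ (with $j\ge0$, $0\le b\le r$, $e\ge 0$ varying) are uniquely determined by the linear equations obtained from (V) and (T), in terms of invariants of genus smaller than $g$ and invariants of genus $g$ with fewer than $n$ marked points.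
   Context: $\bar M_{g,n}(\mathbb P^r,d)$ is the moduli space of $n$-pointed genus-$g$ degree-$d$ stable maps to $\mathbb P^r$, with virtual fundamental class of dimension $(r+1)d+(r-3)(1-g)+n$, cotangent line classes $\psi_{x_i}$ (first Chern class of the line bundle with fiber $T^\vee_{C,x_i}$) and evaluation maps $ev_{x_i}$. The Gromov-Witten invariants are $$\langle\tau_{m_1}(\gamma_1)\cdots\tau_{m_n}(\gamma_n)\rangle_{g,d}=\int_{[\bar M_{g,n}(\mathbb P^r,d)]^{\rm virt}}\psi_{x_1}^{m_1}ev_{x_1}^*\gamma_1\cdots\psi_{x_n}^{m_n}ev_{x_n}^*\gamma_n,$$ zero if the integrand does not have the virtual dimension or if the moduli space is empty (in particular genus-$0$ degree-$0$ invariants with fewer than $3$ marked points are zero); invariants containing $\tau_l$ with $l<0$ are zero. $\tau_0(\gamma)$ is abbreviated $\gamma$. $T_a$ ($0\le a\le r$) is the class of a linear subspace of codimension $a$, and $T^a=T_{r-a}$ is the Poincaré-dual basis. Correlation functions are the formal power series $$\langle\!\langle\tau_{m_1}(\gamma_1)\cdots\tau_{m_n}(\gamma_n)\rangle\!\rangle_g=\sum_{d\ge0}\Big\langle\tau_{m_1}(\gamma_1)\cdots\tau_{m_n}(\gamma_n)\exp\Big(\sum_{m\ge0}t_m^a\tau_m(T_a)\Big)\Big\rangle_{g,d}q^d$$ in $t_m^a$ and $q$. Repeated lower/upper cohomology indices $a,b$ are summed over $0,\dots,r$. $R:A^*(X)\to A^*(X)$ is multiplication by $c_1(X)$, so $(R^p)_a{}^b=(r+1)^p\,\delta_{a+p,b}$.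 For $x\in\mathbb Q$, $k\in\mathbb Z_{\ge-1}$, $0\le p\le k+1$, $[x]^k_p$ denotes the $z^p$-coefficient of $\prod_{j=0}^k(z+x+j)$. The ''linear equations obtained from (V) and (T)'' are those obtained by comparing coefficients of monomials in $q$ and the $t_m^a$. *)

(* Defs.v *)
From HB Require Import structures.
From mathcomp Require Import all_boot all_order all_algebra.
From mathcomp Require Import finmap multiset.

Set Implicit Arguments.
Unset Strict Implicit.
Unset Printing Implicit Defensive.

Import Order.TTheory GRing.Theory Num.Theory.
Local Open Scope ring_scope.
Local Open Scope mset_scope.

(* The pair (m, a) stands for the variable t_m^a, and also for the insertion
   tau_m(T_a).  A finite multiset of such pairs is a monomial in the t's, or an
   unordered list of insertions (all classes of P^r have even degree, so the
   order of the marked points does not matter). *)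
Notation mon r := {mset nat * 'I_r.+1}.

(* [F mu d] is the coefficient of t^mu q^d. *)
Definition series (r : nat) := mon r -> nat -> rat.

Definition submons r (mu : mon r) : seq (mon r) :=
  undup [seq seq_mset (mask b mu) | b : (size mu).-tuple bool].

Lemma mem_submons r (mu nu : mon r) : (nu \in submons mu) = (nu `<=` mu).
Proof.
rewrite /submons mem_undup; apply/idP/idP.
  case/mapP=> b _ ->; apply/msubsetP => x.
  by rewrite mset_seqE -[leqRHS]count_mem_mset leq_count_subseq ?mask_subseq.
move=> /msubsetP le_nu_mu.
have /count_subseqP[s sub_s perm_s] :
    forall x, (count_mem x (nu : seq _) <= count_mem x (mu : seq _))%N.
  by move=> x; rewrite !count_mem_mset.
have /subseqP[b /eqP size_b def_s] := sub_s.
apply/mapP; exists (Tuple size_b); first by rewrite mem_enum.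
by rewrite /= -def_s -[LHS]seq_mset_id; apply/eq_seq_msetP.
Qed.

Definition mul_series r (F G : series r) : series r := fun mu d =>
  \sum_(nu <- submons mu) \sum_(i < d.+1) F nu i * G (mu `\` nu) (d - i)%N.

(* The series \sum_(m >= 0) \sum_a t_m^a * F m a: a variable contributes to the
   coefficient of t^mu only if it divides t^mu. *)
Definition tsum_series r (F : nat -> 'I_r.+1 -> series r) : series r :=
  fun mu d => \sum_(x <- finsupp mu) F x.1 x.2 (mu `\ x) d.

(* A^*(P^r), as coordinates on the basis T_0, ..., T_r. *)
Definition chow (r : nat) := 'rV[rat]_r.+1.

(* T_a, which is 0 for a > r.  The Poincare dual T^a is T_(r - a). *)
Definition T r (a : nat) : chow r := \row_b (b == a :> nat)%:R.
Arguments T {r} a.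

(* Multiplication by T_1, acting on row vectors. *)
Definition hyp (r : nat) : 'M[rat]_r.+1 :=
  \matrix_(a, b) (b == a.+1 :> nat)%:R.

(* Multiplication by c_1(P^r) = (r + 1) T_1, as a matrix acting on
   row vectors; (R^p)_a^b is [(Rc1 r ^+ p) a b]. *)
Definition Rc1 (r : nat) : 'M[rat]_r.+1 := r.+1%:R *: hyp r.

Lemma Rc1_exp r p (a b : 'I_r.+1) :
  (Rc1 r ^+ p) a b = r.+1%:R ^+ p * (b == a + p :> nat)%N%:R.
Proof.
elim: p a b => [|p IH] a b.
  by rewrite !expr0 mul1r addn0 [LHS]mxE eq_sym.
have E c : Rc1 r a c = r.+1%:R * (c == a.+1 :> nat)%:R by rewrite /Rc1 mxE [hyp r a c]mxE.
rewrite exprS [LHS]mxE (eq_bigr (fun c : 'I_r.+1 => r.+1%:R * (c == a.+1 :> nat)%:R * (r.+1%:R ^+ p * (b == c + p :> nat)%N%:R))); last by move=> c _; rewrite E IH.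
move: (r.+1%:R) => q.
case: (ltnP a.+1 r.+1) => h.
  have v : nat_of_ord (Ordinal h) = a.+1 by [].
  rewrite (bigD1 (Ordinal h)) // v eqxx mulr1 addSnnS exprS mulrA [LHS]/=.
  rewrite [X in _ + X = _]big1 ?addr0 // => i ih.
  have /negPf -> : (i != a.+1 :> nat) by rewrite -v; apply: contra ih => /eqP/val_inj ->.
  by rewrite mulr0 mul0r.
rewrite big1 => [|c _]; last by rewrite ltn_eqF ?mulr0 ?mul0r // (leq_trans (ltn_ord c)).
rewrite ltn_eqF ?mulr0 // (leq_trans (ltn_ord b)) // (leq_trans h) //.
by rewrite addnS ltnS leq_addr.
Qed.

(* [I g d A] is the genus g, degree d invariant whose marked points carry the
   insertions in A. *)
Definition invariants (r : nat) := nat -> nat -> mon r -> rat.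

(* < tau_(l_1)(gamma_1) ... tau_(l_n)(gamma_n) A >_(g, d), by multilinearity,
   and zero if some l_i < 0. *)
Fixpoint bracket r (I : invariants r) (g d : nat)
    (s : seq (int * chow r)) (A : mon r) : rat :=
  match s with
  | [::] => I g d A
  | (Posz m, gamma) :: s' =>
      \sum_(c < r.+1) gamma 0 c * bracket I g d s' ((m, c) +` A)
  | (Negz _, _) :: _ => 0
  end.

(* << tau_(l_1)(gamma_1) ... tau_(l_n)(gamma_n) >>_g.  The factorials come from
   the exponential. *)
Definition corr r (I : invariants r) (g : nat) (s : seq (int * chow r)) :
    series r :=
  fun mu d => bracket I g d s mu / (\prod_(x <- finsupp mu) (mu x)`!)%N%:R.

(* << tau_m(gamma1) gamma2 >>^i *)
Fixpoint corr_up r (I : invariants r) (i m : nat) (gamma1 gamma2 : chow r) :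
    series r :=
  match i with
  | 0 => corr I 0 [:: (m%:Z, gamma1); (0, gamma2)]
  | i'.+1 => fun mu d =>
      corr_up I i' m.+1 gamma1 gamma2 mu d
      - \sum_(a < r.+1)
          mul_series (corr I 0 [:: (m%:Z, gamma1); (0, T a)])
                     (corr_up I i' 0 (T (r - a)) gamma2) mu d
  end.

(* Moduli spaces of stable maps and their virtual classes are not available, so
   the invariants of P^r enter through properties that they are known to have:
   in every genus the dimension constraint and vanishing for an empty moduli
   space; in genus 0 the two initial values, the string and divisor equations,
   the topological recursion relation and WDVV.  The latter properties
   determine all genus 0 invariants of P^r (reconstruction theorem of Kontsevich
   and Manin for primary invariants, then the divisor equation and the recursion
   relation for descendants).  Nothing else is assumed for g >= 1. *)
Record GW_invariants (r : nat) (I : invariants r) : Prop := {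
  GW_dim : forall (g d : nat) (A : mon r), I g d A != 0 ->
    (\sum_(x <- A) (x.1 + x.2))%N%:Z
      = r.+1%:Z * d%:Z + (r%:Z - 3) * (1 - g%:Z) + (size A)%:Z;
  GW_empty : forall (g : nat) (A : mon r), (2 * g + size A <= 2)%N ->
    I g 0 A = 0;
  GW0_deg0 : forall a b c : nat,
    (a <= r)%N -> (b <= r)%N -> (c <= r)%N ->
    bracket I 0 0 [:: (0, T a); (0, T b); (0, T c)] mset0
      = (a + b + c == r)%N%:R;
  GW0_line : bracket I 0 1 [:: (0, T r); (0, T r)] mset0 = 1;
  GW0_string : forall (d : nat) (A : mon r), (0 < d)%N || (3 <= size A)%N ->
    bracket I 0 d [:: (0, T 0)] A
      = \sum_(x <- A) bracket I 0 d [:: (x.1%:Z - 1, T x.2)] (A `\ x);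
  GW0_divisor : forall (d : nat) (A : mon r), (0 < d)%N || (3 <= size A)%N ->
    bracket I 0 d [:: (0, T 1)] A
      = d%:R * I 0 d A
        + \sum_(x <- A) bracket I 0 d [:: (x.1%:Z - 1, T x.2 *m hyp r)] (A `\ x);
  GW0_trr : forall (m k l : nat) (a b c : 'I_r.+1) (mu : mon r) (d : nat),
    corr I 0 [:: (m.+1%:Z, T a); (k%:Z, T b); (l%:Z, T c)] mu d
      = \sum_(e < r.+1)
          mul_series (corr I 0 [:: (m%:Z, T a); (0, T e)])
            (corr I 0 [:: (0, T (r - e)); (k%:Z, T b); (l%:Z, T c)]) mu d;
  GW0_wdvv : forall (a b c c' : 'I_r.+1) (mu : mon r) (d : nat),
    \sum_(e < r.+1)
        mul_series (corr I 0 [:: (0, T a); (0, T b); (0, T e)])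
          (corr I 0 [:: (0, T (r - e)); (0, T c); (0, T c')]) mu d
      = \sum_(e < r.+1)
          mul_series (corr I 0 [:: (0, T a); (0, T c); (0, T e)])
            (corr I 0 [:: (0, T (r - e)); (0, T b); (0, T c')]) mu d
}.

(* [x]^k_p *)
Definition brk (x : rat) (k p : nat) : rat :=
  (\prod_(j < k.+1) ('X + (x + j%:R)%:P))`_p.

Definition vcoef (r k p : nat) (a : 'I_r.+1) (m : int) (b : 'I_r.+1) : rat :=
  brk (a%:R + m%:~R + (1 - r%:R) / 2) k p * (Rc1 r ^+ p) a b.

(* The right-hand side of the Virasoro condition, for g >= 1.  The sums over
   p - k <= m <= -1 run over m = - (i + 1) with i < k - p. *)
Definition virasoro r (I : invariants r) (k g : nat) : series r := fun mu d =>
  - (\sum_(p < k.+2) \sum_(b < r.+1)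
       brk ((3 - r%:R) / 2) k p * (Rc1 r ^+ p) ord0 b
       * corr I g [:: (k%:Z + 1 - p%:Z, T b)] mu d)
  + \sum_(p < k.+2)
      tsum_series (fun m a mu' d' => \sum_(b < r.+1)
        vcoef k p a m%:Z b * corr I g [:: (k%:Z + m%:Z - p%:Z, T b)] mu' d') mu d
  + 2^-1 * (\sum_(p < k.+2) \sum_(i < k - p) \sum_(a < r.+1) \sum_(b < r.+1)
      let m : int := - i.+1%:Z in
      (-1) ^ m * vcoef k p a m b
      * corr I g.-1 [:: (- m - 1, T (r - a)); (k%:Z + m - p%:Z, T b)] mu d)
  + 2^-1 * (\sum_(p < k.+2) \sum_(i < k - p) \sum_(h < g.+1)
      \sum_(a < r.+1) \sum_(b < r.+1)
      let m : int := - i.+1%:Z in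
      (-1) ^ m * vcoef k p a m b
      * mul_series (corr I h [:: (- m - 1, T (r - a))])
                   (corr I (g - h) [:: (k%:Z + m - p%:Z, T b)]) mu d).

(* Only the coefficients of t^mu q^e, for all e, are compared. *)
Definition virasoro_eqs r (I : invariants r) (g : nat) (mu : mon r) : Prop :=
  forall k e : nat, (1 <= k)%N -> 0 = virasoro I k g mu e.

Definition trr_eqs r (I : invariants r) (g : nat) (mu : mon r) : Prop :=
  forall (N m : nat) (gamma : chow r) (e : nat), (3 * g - 1 <= N)%N ->
    corr I g [:: ((N + m)%N%:Z, gamma)] mu e
      = \sum_(i < N) \sum_(a < r.+1)
          mul_series (corr_up I i m gamma (T a))
            (corr I g [:: ((N - 1 - i)%N%:Z, T (r - a))]) mu e.

(* Invariants without marked points are left out: they do not occur in the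
   equations and the recursion does not compute them in genus >= 1. *)
Definition agree_below r (I J : invariants r) (g n : nat) : Prop :=
  forall (h d : nat) (A : mon r), (1 <= size A)%N ->
    (h < g)%N || (h == g) && (size A < n)%N -> I h d A = J h d A.

(* Main.v *)
(** Let [X (z^j T_c)] be the generating polynomial in [q] of the differences of the
    invariants of [I] and [J] with insertions [tau_j(T_c)] and [mu], viewed as a linear
    functional on [H[z]], where [H] is the cohomology of [P^r].  Since the lower invariants
    agree, the equations become linear and homogeneous in [X], with genus-0 one- and
    two-point invariants as coefficients.  With the fundamental solution [S] of the quantum
    differential equation of [P^r], put [Xbar f = X ([S^-1 f]_+)].  Unitarity
    [S^-1(z) = S^*(-z)] turns the recursion relations into [Xbar (z^N H) = 0] for
    [N >= 3 g - 1].  The Virasoro operators are the powers of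
    [A_cl = c_1 + z (z d/dz + 3/2 + theta)], where [theta T_a = (a - r/2) T_a], and [S]
    conjugates [A_cl] into the operator [A] in which [c_1] acts by quantum multiplication,
    so that the Virasoro conditions become [Xbar (A^k 1) = 0] for [k >= 2].  Finally
    [A^(r+1) - (r+1)^(r+1) q] maps [z^m H] to [z^(m+1) H[z]], with leading term
    [(r+1) (m + 3/2) c_1^r], and quantum multiplication by [c_1] is invertible up to powers
    of [q]; hence the vectors [A^k 1] generate [H[z] / z^N H[z]] after inverting [q], so
    [Xbar] and [X] vanish. *)

Require Import Defs.
From HB Require Import structures.
From mathcomp Require Import all_boot all_order all_algebra.
From mathcomp Require Import finmap multiset.
From mathcomp Require Import ring zify.

Set Implicit Arguments.
Unset Strict Implicit.
Unset Printing Implicit Defensive.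

Import Order.TTheory GRing.Theory Num.Theory.
Local Open Scope ring_scope.
Local Open Scope mset_scope.

(** * The quantum connection acting on dual sequences *)

(** Small quantum multiplication by [T_1] on row vectors, with ['X] for [q]: the corner entry
    encodes that [T_1] times [T_r] is [q T_0]. *)
Definition qhyp (r : nat) : 'M[{poly rat}]_r.+1 :=
  \matrix_(a, b) ((b == a.+1 :> nat)%:R
                  + ((a == r :> nat) && (b == 0 :> nat))%:R * 'X).

(** The eigenvalue of [z d/dz + 3/2 + theta] on [z^m T_a]. *)
Definition level (r : nat) (m : int) (a : nat) : rat :=
  m%:~R + a%:R + (3 - r%:R) / 2.

Definition level_mx (r : nat) (m : int) : 'M[{poly rat}]_r.+1 :=
  diag_mx (\row_a (level r m a)%:P).

(* A sequence [Y] encodes the functional [z^m T_a |-> Y m a 0] on [H[z, 1/z]];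
   [dualop E] is the transpose of [E + z (z d/dz + 3/2 + theta)]. *)
Definition dualop r (E : 'M[{poly rat}]_r.+1) (Y : int -> 'cV[{poly rat}]_r.+1) :
    int -> 'cV[{poly rat}]_r.+1 :=
  fun m => E *m Y m + level_mx r m *m Y (m + 1).

Lemma qhypE r (a b : 'I_r.+1) :
  qhyp r a b = (b == (a.+1 %% r.+1)%N :> nat)%:R * 'X ^+ (a == r :> nat).
Proof.
rewrite mxE; have [ar|ar] := eqVneq (a : nat) r.
  by rewrite ar modnn ltn_eqF ?add0r //= expr1.
by rewrite modn_small ?addr0 ?mulr1 ?mul0r ?addr0 // ltnS ltn_neqAle ar -ltnS ltn_ord.
Qed.

Lemma row_qhyp_exp r (j : nat) :
  row ord0 (qhyp r ^+ j) = 'X ^+ (j %/ r.+1) *: delta_mx 0 (inord (j %% r.+1)).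
Proof.
elim: j => [|j IH].
  rewrite expr0 div0n mod0n scale1r (_ : inord 0 = ord0); last exact/val_inj/inordK.
  by apply/rowP => b; rewrite !mxE eqxx eq_sym.
rewrite (exprSr (qhyp r)) -[_ * _]/(_ *m _) row_mul IH -scalemxAl -rowE.
have lt_j : (j %% r.+1 < r.+1)%N by rewrite ltn_pmod.
have jS : (j.+1 %% r.+1 = (j %% r.+1).+1 %% r.+1)%N by rewrite -addn1 -modnDml addn1.
have -> : ((j.+1 %/ r.+1) = (j %% r.+1 == r) + j %/ r.+1)%N.
  rewrite divnS // /dvdn jS; congr (nat_of_bool _ + _)%N.
  have [->|nr] := eqVneq (j %% r.+1)%N r; first by rewrite modnn.
  by rewrite modn_small // ltn_neqAle eqSS nr.
apply/rowP => b; rewrite mxE [row _ _ _ _]mxE qhypE inordK // !mxE /=.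
rewrite -[b == _]val_eqE /= inordK ?ltn_pmod // jS exprD; ring.
Qed.

(** Every basis vector is a quantum power of [T_1], so row 0 of the powers decides. *)
Lemma qhyp_exp_period r : qhyp r ^+ r.+1 = 'X%:M.
Proof.
apply/row_matrixP => a.
have row_a : row a 1%:M = row ord0 (qhyp r ^+ a) :> 'rV[{poly rat}]_r.+1.
  by rewrite row_qhyp_exp divn_small // modn_small // scale1r inord_val rowE mulmx1.
rewrite -[qhyp r ^+ r.+1]mul1mx [LHS]row_mul row_a -row_mul.
rewrite -[_ *m _]/(qhyp r ^+ a * qhyp r ^+ r.+1) -exprD row_qhyp_exp.
rewrite divnDr ?dvdnn // divnn divn_small // modnDr modn_small // inord_val expr1.
by apply/rowP => b; rewrite !mxE eqxx /= eq_sym mulr_natr.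
Qed.

Lemma qhyp_diag r (f : nat -> {poly rat}) :
  qhyp r *m diag_mx (\row_a f a)
    = diag_mx (\row_a f (a.+1 %% r.+1)%N) *m qhyp r.
Proof.
rewrite mul_mx_diag mul_diag_mx; apply/matrixP => a b.
rewrite [LHS]mxE [RHS]mxE qhypE [X in _ * X = _]mxE [X in _ = X * _]mxE.
by case: eqP => [->|]; rewrite ?mul0r ?mulr0 // mulrC.
Qed.

Lemma qhyp_exp_level r (m : int) (s : nat) :
  qhyp r ^+ s *m level_mx r m
    = diag_mx (\row_a (level r m ((a + s) %% r.+1))%:P) *m qhyp r ^+ s.
Proof.
elim: s => [|s IH].
  rewrite expr0 mul1mx mulmx1; congr diag_mx; apply/rowP => a.
  by rewrite !mxE addn0 modn_small.
rewrite exprS -[_ * _]/(_ *m _) -mulmxA IH mulmxA.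
rewrite (qhyp_diag r (fun a => (level r m ((a + s) %% r.+1))%:P)) -mulmxA.
by congr (diag_mx _ *m _); apply/rowP => a; rewrite !mxE modnDml addSnnS.
Qed.

Lemma sum_level r (m : int) :
  \sum_(b < r.+1) level r m b = r.+1%:R * (m%:~R + 3 / 2).
Proof.
have gauss (x y : rat) n :
    \sum_(b < n) (x + b%:R + y) = n%:R * (x + y) + n%:R * (n%:R - 1) / 2.
  elim: n => [|n IH]; first by rewrite big_ord0 !mul0r addr0.
  by rewrite big_ord_recr /= IH -[n.+1]addn1 natrD; field.
by rewrite gauss -[r.+1]addn1 natrD; field.
Qed.

(** Moving [level_mx] to the left past [qhyp r ^+ s] shifts its diagonal cyclically by [s]. Summed
    over [s], each diagonal entry collects all the levels, and [theta] is traceless. *)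
Lemma sum_qhyp_level r (m : int) :
  \sum_(s < r.+1) qhyp r ^+ s *m level_mx r m *m qhyp r ^+ (r - s)
    = (r.+1%:R * (m%:~R + 3 / 2))%:P *: qhyp r ^+ r.
Proof.
under eq_bigr => s _.
  rewrite qhyp_exp_level -mulmxA -[_ *m qhyp r ^+ (r - s)]/(_ * _) -exprD subnKC;
    last by rewrite -ltnS.
  over.
rewrite -mulmx_suml -mul_scalar_mx; congr (_ *m _).
apply/matrixP => a b; rewrite summxE !mxE.
under eq_bigr => s _ do rewrite !mxE.
rewrite sumrMnl -sum_level [in RHS](reindex_inj (addrI a)) rmorph_sum /=.
by congr (_ *+ _); apply: eq_bigr.
Qed.

(** * Iterates of the dual operator near the top of the support *)

Section DualOperator.

Variables (r : nat) (E : 'M[{poly rat}]_r.+1).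
Implicit Types (Y : int -> 'cV[{poly rat}]_r.+1).

Lemma iter_dualop_ext k Y Y' (N : nat) :
  (forall i : nat, (N <= i <= N + k)%N -> Y i = Y' i) ->
  iter k (dualop E) Y N = iter k (dualop E) Y' N.
Proof.
elim: k N => [|k IH] N eqY /=; first by apply: eqY; rewrite addn0 leqnn.
rewrite /dualop -PoszD addn1 IH => [|i lei]; last by apply: eqY; lia.
by rewrite (IH N.+1) // => i lei; apply: eqY; lia.
Qed.

Lemma iter_dualop_sub k c Y Y' (N : int) :
  iter k (dualop E) (fun m => Y m - c *: Y' m) N
    = iter k (dualop E) Y N - c *: iter k (dualop E) Y' N.
Proof.
elim: k N => [|k IH] N //=.
rewrite /dualop !IH !mulmxBr -!scalemxAr scalerDr opprD !addrA.
by congr (_ - _); rewrite addrAC.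
Qed.

Lemma iter_dualop_above k Y (M N : nat) :
  (forall i : nat, (M <= i)%N -> Y i = 0) -> (M <= N)%N ->
  iter k (dualop E) Y N = 0.
Proof.
move=> Y0; elim: k N => [|k IH] N le_MN /=; first exact: Y0.
by rewrite /dualop -PoszD addn1 !IH ?mulmx0 ?addr0 // leqW.
Qed.

Lemma iter_dualop_top k Y (M : nat) :
  (forall i : nat, (M < i)%N -> Y i = 0) ->
  iter k (dualop E) Y M = E ^+ k *m Y M.
Proof.
move=> Y0; elim: k => [|k IH] /=; first by rewrite mul1mx.
rewrite /dualop -PoszD addn1 (iter_dualop_above (N := M.+1) k Y0) // IH mulmx0 addr0.
by rewrite mulmxA exprS.
Qed.

(** With nothing beyond [M.+1], at most one of the [k] factors contributes its shift term; [s]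
    counts the copies of [E] to its left. *)
Lemma iter_dualop_subtop k Y (M : nat) :
  (forall i : nat, (M.+1 < i)%N -> Y i = 0) ->
  iter k (dualop E) Y M = E ^+ k *m Y M
    + \sum_(s < k) E ^+ s *m level_mx r M *m E ^+ (k.-1 - s) *m Y M.+1.
Proof.
move=> Y0; elim: k => [|k IH] /=; first by rewrite mul1mx big_ord0 addr0.
rewrite /dualop -PoszD addn1 (iter_dualop_top k Y0) IH big_ord_recl /= expr0 mul1mx subn0.
rewrite mulmxDr mulmxA -[E *m _]/(E * _) -exprS -addrA; congr (_ + _).
rewrite addrC mulmxA; congr (_ + _); rewrite mulmx_sumr; apply: eq_bigr => s _.
rewrite /bump /= add1n !mulmxA exprS; congr (_ *m _ ^+ _ *m _).
by rewrite subnS -!subn1 subnAC.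
Qed.

End DualOperator.

(* Induction on the support: [E] being quantum multiplication by [c_1], the operator
   [dualop E ^+ r.+1 - r.+1 ^+ r.+1 q] lowers the top degree of [Y] from [m.+1] to [m] and
   multiplies the top coefficient by [r.+1 (m + 3/2) E ^+ r], which is injective. *)
Lemma quantum_cyclic r (Y : int -> 'cV[{poly rat}]_r.+1) (M : nat) :
  (forall N : nat, (M <= N)%N -> Y N = 0) ->
  (forall k, (2 <= k)%N ->
     iter k (dualop (r.+1%:R *: qhyp r)) Y 0 ord0 ord0 = 0) ->
  forall N : nat, Y N = 0.
Proof.
set E := _ *: qhyp r.
have EX k : E ^+ k = r.+1%:R ^+ k *: qhyp r ^+ k by rewrite /E exprZn.
have nz k : r.+1%:R ^+ k != 0 :> {poly rat}.
  by rewrite expf_neq0 // -polyC_natr polyC_eq0 pnatr_eq0.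
have qhyp_inj n (v : 'cV[{poly rat}]_r.+1) : qhyp r ^+ n *m v = 0 -> v = 0.
  elim: n v => [|n IH] v; first by rewrite mul1mx.
  rewrite exprSr -[_ * _]/(_ *m _) -mulmxA => /IH qv0.
  have : qhyp r ^+ r.+1 *m v = 0.
    by rewrite exprSr -[_ * _]/(_ *m _) -mulmxA qv0 mulmx0.
  rewrite qhyp_exp_period mul_scalar_mx => /eqP; rewrite scalemx_eq0.
  by rewrite polyX_eq0 => /eqP.
elim: M Y => [|M IH] Y Y0 evY; first by move=> N; apply: Y0.
suff YM0 : Y M = 0.
  apply: IH => // N; rewrite leq_eqVlt => /predU1P[<- //|]; exact: Y0.
have top k : iter k (dualop E) Y M = E ^+ k *m Y M by exact: iter_dualop_top.
case: M => [|M] in IH Y0 top *.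
  (* The conditions begin at [k = 2], so the exponents [a + 2] yield the rows [a] of
     [qhyp r ^+ 2]. *)
  suff: qhyp r ^+ 2 *m Y 0 = 0 by apply: qhyp_inj.
  apply/row_matrixP => a; rewrite row0 row_mul.
  have := evY (a + 2)%N (leq_addl _ _); rewrite (top (a + 2)%N) EX -scalemxAl mxE.
  move/eqP; rewrite mulf_eq0 (negPf (nz _)) /= => /eqP ev0.
  have -> : row a (qhyp r ^+ 2) = row ord0 (qhyp r ^+ (a + 2)).
    rewrite exprD -[_ * _]/(_ *m _) row_mul row_qhyp_exp.
    by rewrite divn_small // modn_small // scale1r inord_val rowE.
  by rewrite -row_mul; apply/rowP => j; rewrite ord1 !mxE -[RHS]ev0 mxE.
set c0 : {poly rat} := r.+1%:R ^+ r.+1 * 'X.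
pose Y' (N : int) := iter r.+1 (dualop E) Y N - c0 *: Y N.
have Ep : E ^+ r.+1 = c0%:M by rewrite EX qhyp_exp_period scale_scalar_mx.
have Y'0 N : (M < N)%N -> Y' N = 0.
  rewrite leq_eqVlt /Y' => /predU1P[<-|lt_MN].
    by rewrite top Ep mul_scalar_mx subrr.
  by rewrite (iter_dualop_above _ _ Y0) // Y0 // scaler0 subrr.
(* The scalar [c0] commutes with [dualop E], so this combines the conditions on [Y] at [k + r.+1]
   and [k]. *)
have evY' k : (2 <= k)%N -> iter k (dualop E) Y' 0 ord0 ord0 = 0.
  move=> le2k; rewrite /Y' iter_dualop_sub -iterD !mxE.
  by rewrite evY ?evY ?mulr0 ?subrr // (leq_trans le2k) ?leq_addr.
have := IH Y' Y'0 evY' M.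
rewrite /Y' iter_dualop_subtop // Ep mul_scalar_mx addrC addKr /= => sum0.
have {sum0} : (r.+1%:R * (M%:~R + 3 / 2))%:P *: (qhyp r ^+ r *m Y M.+1) = 0.
  rewrite scalemxAl -sum_qhyp_level mulmx_suml.
  have /eqP : r.+1%:R ^+ r *: \sum_(s < r.+1)
      qhyp r ^+ s *m level_mx r M *m qhyp r ^+ (r - s) *m Y M.+1 = 0.
    rewrite -[RHS]sum0 scaler_sumr; apply: eq_bigr => s _; rewrite !EX.
    rewrite -!scalemxAl -!scalemxAr -!scalemxAl scalerA -exprD subnKC //.
    by rewrite -ltnS.
  by rewrite scalemx_eq0 (negPf (nz r)) /= => /eqP.
move/eqP; rewrite scalemx_eq0 polyC_eq0 mulf_eq0 pnatr_eq0 /=.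
have /negPf -> /= : M%:~R + 3 / 2 != 0 :> rat.
  by rewrite gt_eqF // ltr_wpDl // ?ler0z.
by move/eqP/qhyp_inj.
Qed.

(** Multiplication by [c_1] raises the codimension by one, the other summand raises [m] by one;
    either way the level grows by one. So the [j]-th factor from the outside always sees
    [level r m a + j], which yields the Virasoro coefficients. *)
Lemma iter_classical r n (Y : int -> 'cV[{poly rat}]_r.+1) (m : int) a :
  iter n (dualop (map_mx polyC (Rc1 r))) Y m a 0
    = \sum_(p < n.+1) \sum_(b < r.+1)
        ((\prod_(j < n) ('X + (level r m a + j%:R)%:P))`_p
         * (Rc1 r ^+ p) a b)%:P * Y (m + n%:Z - p%:Z) b 0.
Proof.
elim: n Y => [|n IH] Y.
  rewrite /= big_ord1 big_ord0 coef1 /= (bigD1 a) //= expr0 mxE eqxx mulr1 mul1r.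
  rewrite big1 ?addr0 ?subr0 // => b ab.
  by rewrite mxE eq_sym (negPf ab) mulr0 mul0r.
rewrite iterSr IH; set P := \prod_(j < n) _.
have szP : (size P <= n.+1)%N.
  have := size_prod_leq predT (fun j : 'I_n => 'X + (level r m a + j%:R)%:P).
  rewrite (eq_bigr (fun=> 2%N)) => [|j _]; last by rewrite size_XaddC.
  by rewrite sum_nat_const card_ord; move/leq_trans; apply; lia.
have coefPX p : (P * ('X + (level r m a + n%:R)%:P))`_p
    = (if p == 0 then 0 else P`_p.-1) + P`_p * (level r m a + n%:R).
  by rewrite mulrDr coefD coefMX coefMC.
transitivity (\sum_(p < n.+1) \sum_(b < r.+1)
      (P`_p * (Rc1 r ^+ p.+1) a b)%:P * Y (m + n%:Z - p%:Z) b 0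
   + \sum_(p < n.+1) \sum_(b < r.+1)
      (P`_p * (level r m a + n%:R) * (Rc1 r ^+ p) a b)%:P
        * Y (m + n.+1%:Z - p%:Z) b 0).
  rewrite -big_split; apply: eq_bigr => p _ /=.
  rewrite /dualop; under eq_bigr => b _ do rewrite mxE mulrDr.
  rewrite big_split /=; congr (_ + _).
    under eq_bigr => b _ do rewrite mxE mulr_sumr.
    rewrite exchange_big; apply: eq_bigr => c _ /=.
    rewrite exprSr mxE mulr_sumr rmorph_sum mulr_suml; apply: eq_bigr => b _.
    by rewrite [map_mx _ _ _ _]mxE /= !polyCM !mulrA.
  apply: eq_bigr => b _; rewrite Rc1_exp mul_diag_mx !mxE mulrA -polyCM.
  have -> : m + n%:Z - p%:Z + 1 = m + n.+1%:Z - p%:Z by lia.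
  congr (polyC _ * _); case: eqP => [bE|_]; last by rewrite !mulr0 mul0r.
  by rewrite /level bE !natrD !(intrD, intrB) /=; ring.
under [RHS]eq_bigr => p _ do
  under eq_bigr => b _ do rewrite big_ord_recr /= -/P coefPX mulrDl polyCD mulrDl.
under [RHS]eq_bigr => p _ do rewrite big_split /=.
rewrite big_split /=; congr (_ + _).
  rewrite [RHS]big_ord_recl [X in _ = X + _]big1 => [|b _]; last by rewrite /= !mul0r.
  rewrite add0r.
  apply: eq_bigr => p _; apply: eq_bigr => b _.
  by rewrite lift0 /=; congr (_ * Y _ _ _); lia.
rewrite [RHS]big_ord_recr /= [X in _ = _ + X]big1 ?addr0 // => b _.
by rewrite nth_default ?mul0r.
Qed.

(* The transpose of multiplication by [\sum_j Q j z^-j]. *)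
Definition conv r (Q : nat -> 'M[{poly rat}]_r.+1) (n : nat)
    (Y : int -> 'cV[{poly rat}]_r.+1) : int -> 'cV[{poly rat}]_r.+1 :=
  fun N => \sum_(j < n) Q j *m Y (N - j%:Z).

(** * Intertwining of two dual operators by a flat series in [1/z] *)

Section Convolution.

Variables (r : nat) (Q : nat -> 'M[{poly rat}]_r.+1).
Variables (E E' : 'M[{poly rat}]_r.+1).
Hypothesis Q0 : Q 0 = 1%:M.
Hypothesis flat : forall (N : int) (j : nat),
  Q j *m E + Q j.+1 *m level_mx r (N - j.+1%:Z)
    = E' *m Q j + level_mx r N *m Q j.+1.

(** [flat] handles the [E] term of index [j] together with the level term of index [j.+1], both
    applied to [Y (N - j)]. The level terms of index 0 agree by [Q0]; the [E] terms of index [n],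
    cut off from their partners, vanish by the hypothesis on [Y]. *)
Lemma conv_dualop n Y (N : int) : Y (N - n%:Z) = 0 ->
  conv Q n.+1 (dualop E Y) N = dualop E' (conv Q n.+1 Y) N.
Proof.
move=> Y0; rewrite /conv /dualop.
under eq_bigr => j _ do rewrite mulmxDr !mulmxA.
rewrite big_split /= mulmx_sumr.
rewrite [X in X + _]big_ord_recr [X in _ + X]big_ord_recl /= Y0 mulmx0 addr0.
rewrite [in RHS]big_ord_recr /= Y0 !mulmx0 addr0.
rewrite [X in _ = _ + X]mulmx_sumr [X in _ = _ + X]big_ord_recl /=.
rewrite Q0 !mul1mx subr0 addr0 [LHS]addrCA [RHS]addrCA; congr (_ + _).
rewrite -!big_split; apply: eq_bigr => j _ /=.
have [eqN eqN'] : N - j.+1%:Z + 1 = N - j%:Z /\ N + 1 - j.+1%:Z = N - j%:Z by lia.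
by rewrite /bump /= add1n eqN eqN' !mulmxA -!mulmxDl flat.
Qed.

Lemma iter_dualop_below F Y k (m : int) :
  (forall i : int, i < 0 -> Y i = 0) -> m < - k%:Z ->
  iter k (dualop (r := r) F) Y m = 0.
Proof.
move=> Y0; elim: k m => [|k IH] m lt_m /=; first by apply: Y0; lia.
by rewrite /dualop !IH ?mulmx0 ?addr0 //; lia.
Qed.

(** Each application extends the support downwards by at most one, so [N + k <= n] keeps the
    truncated terms zero. *)
Lemma conv_iter_dualop n Y k (N : int) :
  (forall i : int, i < 0 -> Y i = 0) -> N + k%:Z <= n%:Z ->
  conv Q n.+1 (iter k (dualop E) Y) N = iter k (dualop E') (conv Q n.+1 Y) N.
Proof.
move=> Y0; elim: k N => [|k IH] N le_n //=.
rewrite conv_dualop; last by apply: iter_dualop_below => //; lia.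
by rewrite /dualop !IH //; lia.
Qed.

End Convolution.

(* [S] and [Q] are mutually inverse series in [1/z], and [u i m] stands for the matrix of
   [<< tau_m(_) _ >>^i] at [t = 0]. *)
Lemma two_point_inverse r (S Q : nat -> 'M[{poly rat}]_r.+1)
    (u : nat -> nat -> 'M[{poly rat}]_r.+1) :
  S 0 = 1%:M -> Q 0 = 1%:M ->
  (forall n, \sum_(j < n.+2) S j *m Q (n.+1 - j)%N = 0) ->
  (forall m, u 0 m = S m.+1) ->
  (forall i m, u i.+1 m = u i m.+1 - S m.+1 *m u i 0) ->
  forall i, u i 0 = - Q i.+1.
Proof.
move=> S0 Q0 SQ u0 uS i.
suff uE m : u i m = - \sum_(j < m.+1) S j *m Q (i.+1 + m - j)%N.
  by rewrite uE big_ord1 S0 mul1mx subn0 addn0.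
elim: i m => [|i IH] m.
  rewrite u0; have := SQ m; rewrite big_ord_recr /= subnn Q0 mulmx1.
  by move/eqP; rewrite addrC addr_eq0 => /eqP.
rewrite uS IH (IH 0) big_ord1 S0 mul1mx subn0 addn0 mulmxN opprK big_ord_recr /=.
have -> : (i.+1 + m.+1 - m.+1 = i.+1)%N by lia.
rewrite opprD subrK; congr (- _); apply: eq_bigr => j _.
by rewrite addnS.
Qed.

(** Convolution with [Q] turns the classical operator into the quantum one, so [quantum_cyclic]
    kills the transformed sequence. As [Q 0 = 1], the transformation is unitriangular, hence
    injective. *)
Lemma dual_sequence_eq0 r (Q : nat -> 'M[{poly rat}]_r.+1)
    (X : int -> 'cV[{poly rat}]_r.+1) (M : nat) :
  Q 0 = 1%:M ->
  (forall (N : int) (j : nat),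
    Q j *m map_mx polyC (Rc1 r) + Q j.+1 *m level_mx r (N - j.+1%:Z)
      = (r.+1%:R *: qhyp r) *m Q j + level_mx r N *m Q j.+1) ->
  (forall m : int, m < 0 -> X m = 0) ->
  (forall N : nat, (M <= N)%N -> conv Q N.+1 X N = 0) ->
  (forall k, (2 <= k)%N ->
     conv Q k.+1 (iter k (dualop (map_mx polyC (Rc1 r))) X) 0 ord0 ord0 = 0) ->
  forall N : nat, X N = 0.
Proof.
move=> Q0 flat X0 trr vir.
pose Y (N : int) := conv Q `|N|.+1 X N.
have convE (n N : nat) : (N <= n)%N -> conv Q n.+1 X N = Y N.
  move=> le_Nn; rewrite /Y /conv /=; have [d ->] : exists d, n.+1 = (N.+1 + d)%N.
    by exists (n - N)%N; lia.
  rewrite big_split_ord /= [X in _ + X]big1 ?addr0 // => j _.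
  by rewrite X0 ?mulmx0 //; lia.
have Y0 : forall N : nat, Y N = 0.
  apply: (quantum_cyclic trr) => k le2k.
  rewrite -(vir k le2k) (conv_iter_dualop Q0 flat X0) ?add0r //.
  congr (fun_of_matrix _ _ _); apply: iter_dualop_ext => i; rewrite add0n => lei.
  by rewrite convE.
move=> N; elim/ltn_ind: N => N IH; have := Y0 N.
rewrite /Y /conv /= big_ord_recl Q0 mul1mx subr0 big1 ?addr0 // => j _.
rewrite lift0; have -> : N%:Z - j.+1%:Z = (N - j.+1)%N%:Z by have := ltn_ord j; lia.
by rewrite IH ?mulmx0 //; have := ltn_ord j; lia.
Qed.

(** * Multisets and generating polynomials *)

Lemma perm_mset1D (K : choiceType) (x : K) (A : {mset K}) :
  perm_eq (x +` A) (x :: A).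
Proof. by apply/eq_seq_msetP; rewrite mset_cons !seq_mset_id. Qed.

Lemma big_mset1D (K : choiceType) (R : Type) (idx : R)
    (op : Monoid.com_law idx) (x : K) (A : {mset K}) (F : K -> R) :
  \big[op/idx]_(y <- x +` A) F y = op (F x) (\big[op/idx]_(y <- A) F y).
Proof. by rewrite (perm_big _ (perm_mset1D x A)) big_cons. Qed.

Lemma sum_mset1D (K : choiceType) (V : nmodType) (x : K) (A : {mset K})
    (F : K -> V) :
  \sum_(y <- x +` A) F y = F x + \sum_(y <- A) F y.
Proof. exact: big_mset1D. Qed.

Lemma size_mset1D (K : choiceType) (x : K) (A : {mset K}) :
  size (x +` A) = (size A).+1.
Proof. by rewrite (perm_size (perm_mset1D x A)). Qed.

Lemma mset3_rev (K : choiceType) (x y z : K) :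
  x +` [mset y; z] = z +` [mset y; x].
Proof. by rewrite msetDCA [[mset x] `+` _]msetDC msetDCA. Qed.

Lemma bracket_T r (I : invariants r) g d (m : nat) (c : 'I_r.+1) s A :
  bracket I g d ((m%:Z, T c) :: s) A = bracket I g d s ((m, c) +` A).
Proof.
rewrite /= (bigD1 c) //= mxE eqxx mul1r big1 ?addr0 // => b bc.
by rewrite mxE (negPf bc : _ == _ :> nat = false) mul0r.
Qed.

Lemma bracket_T1 r (I : invariants r) g d (m : nat) (c : 'I_r.+1) A :
  bracket I g d [:: (m%:Z, T c)] A = I g d ((m, c) +` A).
Proof. exact: bracket_T. Qed.

Lemma bracket_pred r (I : invariants r) g d (m : nat) (c : 'I_r.+1) A :
  bracket I g d [:: (m%:Z - 1, T c)] A
    = if m is m'.+1 then I g d ((m', c) +` A) else 0.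
Proof.
case: m => [|m] //; have -> : m.+1%:Z - 1 = m%:Z by lia.
exact: bracket_T1.
Qed.

Lemma corr_mset0 r (I : invariants r) g s d :
  corr I g s mset0 d = bracket I g d s mset0.
Proof. by rewrite /corr finsupp0 big_seq_fset0 divr1. Qed.

Lemma mul_series_mset0 r (F G : series r) d :
  mul_series F G mset0 d = \sum_(i < d.+1) F mset0 i * G mset0 (d - i)%N.
Proof.
have sub0 : perm_eq (submons (mset0 : mon r)) [:: mset0].
  apply: uniq_perm; rewrite ?undup_uniq // => nu.
  by rewrite mem_submons msubset0 inE.
by rewrite /mul_series (perm_big _ sub0) big_seq1; apply: eq_bigr => i _; rewrite msetBxx.
Qed.

(** By the dimension constraint at most one degree contributes, so the series in [q] is a
    polynomial; the length is a crude bound. *)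
Definition gw_poly r (I : invariants r) (g : nat) (A : mon r) : {poly rat} :=
  \poly_(d < (\sum_(x <- A) (x.1 + x.2) + `|((r%:Z - 3) * (1 - g%:Z))%R|).+1%N) I g d A.

Lemma coef_gw_poly r (I : invariants r) g A d : GW_invariants I ->
  (gw_poly I g A)`_d = I g d A.
Proof.
move=> hI; rewrite coef_poly; case: ltnP => // lt_d; apply/esym/eqP.
apply: contraTT lt_d => /(GW_dim hI) dimA; rewrite -ltnNge.
have : d%:Z <= r.+1%:Z * d%:Z by rewrite ler_peMl.
move: dimA; set s := \sum_(x <- A) _; set c := (r%:Z - 3) * _.
by move: (r.+1%:Z * _) => e; lia.
Qed.

(** * Genus 0 *)

Section GenusZero.

Variables (r : nat) (I : invariants r).
Hypothesis hI : GW_invariants I.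

Let pt := (nat * 'I_r.+1)%type.

Definition two_point (x y : pt) : {poly rat} := gw_poly I 0 [mset x; y].

Definition three_point (x y z : pt) : {poly rat} :=
  gw_poly I 0 (x +` [mset y; z]).

Lemma two_pointC x y : two_point x y = two_point y x.
Proof. by rewrite /two_point msetDC. Qed.

Lemma three_pointC x y z : three_point x y z = three_point y x z.
Proof. by rewrite /three_point msetDCA. Qed.

Lemma three_pointA x y z : three_point x y z = three_point y z x.
Proof. by rewrite /three_point msetDC -msetDA. Qed.

Lemma coef_two_point x y d : (two_point x y)`_d = I 0 d [mset x; y].
Proof. exact: coef_gw_poly. Qed.

Lemma coef_three_point x y z d :
  (three_point x y z)`_d = I 0 d (x +` [mset y; z]).
Proof. exact: coef_gw_poly. Qed.

Lemma two_point_deg0 x y : (two_point x y)`_0 = 0.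
Proof.
rewrite coef_two_point (GW_empty hI) // -[[mset y]]msetD0.
by rewrite !size_mset1D size_mset0.
Qed.

Lemma two_point_dim x y d : (two_point x y)`_d != 0 ->
  r.+1%:Z * d%:Z + r%:Z = x.1%:Z + x.2%:Z + (y.1%:Z + y.2%:Z) + 1.
Proof.
rewrite coef_two_point => /(GW_dim hI).
rewrite -[[mset y]]msetD0 !size_mset1D !big_mset1D size_mset0 big_mset0 subr0 mulr1 /=.
by move: (r.+1%:Z * _) => e; lia.
Qed.

Lemma three_point_dim x y z d : (three_point x y z)`_d != 0 ->
  r.+1%:Z * d%:Z + r%:Z = x.1%:Z + x.2%:Z + (y.1%:Z + y.2%:Z + (z.1%:Z + z.2%:Z)).
Proof.
rewrite coef_three_point => /(GW_dim hI).
rewrite -[[mset z]]msetD0 !size_mset1D !big_mset1D size_mset0 big_mset0 subr0 mulr1 /=.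
by move: (r.+1%:Z * _) => e; lia.
Qed.

Lemma three_point_trr m a y z :
  three_point (m.+1, a) y z
    = \sum_(e < r.+1) two_point (m, a) (0%N, e)
                      * three_point (0%N, rev_ord e) y z.
Proof.
case: y z => [k b] [l c]; apply/polyP => d.
rewrite coef_sum coef_three_point.
have := GW0_trr hI m k l a b c mset0 d; rewrite corr_mset0 !bracket_T /= msetD0.
rewrite mset3_rev => ->; apply: eq_bigr => e _; rewrite mul_series_mset0 coefM.
apply: eq_bigr => i _; rewrite !corr_mset0.
rewrite -[(r - e)%N]/(rev_ord e : nat).
rewrite !bracket_T /= coef_two_point coef_three_point msetD0 [_ +` [mset (m, a)]]msetDC.
by rewrite msetD0 mset3_rev.
Qed.

(** Each term of the recursion relation carries a two-point factor, which has no [q^0] term. *)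
Lemma three_point_desc_deg0 m a y z : (three_point (m.+1, a) y z)`_0 = 0.
Proof.
rewrite three_point_trr coef_sum big1 // => e _.
by rewrite coef0M two_point_deg0 mul0r.
Qed.

Lemma string_two_point d m n a b : (0 < d)%N ->
  (three_point (0%N, ord0) (m, a) (n, b))`_d
    = (if m is m'.+1 then (two_point (m', a) (n, b))`_d else 0)
      + (if n is n'.+1 then (two_point (m, a) (n', b))`_d else 0).
Proof.
move=> d0; rewrite coef_three_point.
have := GW0_string hI (d := d) (A := [mset (m, a); (n, b)]).
rewrite d0 => /(_ isT); rewrite -[T 0]/(T (@ord0 r)) bracket_T1 => ->.
rewrite -[[mset (n, b)]]msetD0 !sum_mset1D big_mset0 addr0 msetD0.
rewrite msetD1K [(m, a) +` _]msetDC msetD1K !bracket_pred /=.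
case: m => [|m]; case: n => [|n]; rewrite ?coef_two_point //=.
- by rewrite [_ +` [mset (0%N, a)]]msetDC.
- by rewrite [_ +` [mset (n, _)]]msetDC.
Qed.

Lemma string_desc_desc m n a b :
  three_point (0%N, ord0) (m.+1, a) (n.+1, b)
    = two_point (m, a) (n.+1, b) + two_point (m.+1, a) (n, b).
Proof.
apply/polyP => -[|d]; rewrite coefD.
  by rewrite three_pointC three_point_desc_deg0 !two_point_deg0 addr0.
exact: string_two_point.
Qed.

Lemma string_prim_desc n a b :
  three_point (0%N, ord0) (0%N, a) (n.+1, b) = two_point (0%N, a) (n, b).
Proof.
apply/polyP => -[|d]; last by rewrite string_two_point // add0r.
by rewrite -three_pointA three_point_desc_deg0 two_point_deg0.
Qed.

(** Two evaluations of [<< T_0 tau_(m+1)(T_a) tau_(n+1)(T_b) >>] at [t = 0]: the string equation and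
    the recursion relation. *)
Lemma two_point_split m n a b :
  two_point (m, a) (n.+1, b) + two_point (m.+1, a) (n, b)
    = \sum_(e < r.+1) two_point (m, a) (0%N, e)
                      * two_point (0%N, rev_ord e) (n, b).
Proof.
rewrite -string_desc_desc three_pointC three_point_trr.
by apply: eq_bigr => e _; rewrite -three_pointC string_prim_desc.
Qed.

(** Turns the one-point invariants of the quadratic Virasoro terms into entries of row 0 of
    [fund_inv], up to sign. *)
Lemma string_one_point n a d :
  (two_point (n, a) (0%N, ord0))`_d
    = if n is n'.+1 then I 0 d [mset (n', a)] else 0.
Proof.
have [->|d0] := posnP d.
  rewrite two_point_deg0; case: n => // n; rewrite (GW_empty hI) //.
  by rewrite -[[mset _]]msetD0 size_mset1D size_mset0.
rewrite coef_two_point msetDC; have := GW0_string hI (d := d) (A := [mset (n, a)]).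
rewrite d0 => /(_ isT); rewrite -[T 0]/(T (@ord0 r)) bracket_T1 => ->.
rewrite -[[mset (n, a)]]msetD0 sum_mset1D big_mset0 addr0 msetD1K bracket_pred /=.
by case: n => // n; rewrite msetD0.
Qed.

(* The coefficient of [z^-n] in the fundamental solution. *)
Definition fund (n : nat) : 'M[{poly rat}]_r.+1 :=
  if n is n'.+1 then \matrix_(a, c) two_point (n', a) (0%N, rev_ord c) else 1%:M.

(* [(-1)^n] times the Poincare adjoint of [fund n]. *)
Definition fund_inv (n : nat) : 'M[{poly rat}]_r.+1 :=
  if n is n'.+1 then
    \matrix_(b, a) ((-1) ^+ n * two_point (n', rev_ord a) (0%N, b))
  else 1%:M.

Lemma fund_invS n b a :
  fund_inv n.+1 b a = (-1) ^+ n.+1 * two_point (n, rev_ord a) (0%N, b).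
Proof. by rewrite mxE. Qed.

(** Unitarity of the fundamental solution: by [two_point_split] the interior terms telescope, and
    the end values cancel the terms [j = 0] and [j = n.+1]. *)
Lemma fund_mul_inv n : \sum_(j < n.+2) fund j *m fund_inv (n.+1 - j)%N = 0.
Proof.
rewrite big_ord_recl big_ord_recr /= subn0 subnn mul1mx mulmx1.
apply/matrixP => a b; rewrite mxE [X in _ + X]mxE summxE [X in _ + (_ + X)]mxE [RHS]mxE.
pose f j := (-1) ^+ (n - j) * two_point (j, a) ((n - j)%N, rev_ord b).
rewrite (eq_bigr (fun j : 'I_n => - (f j.+1 - f j))) => [|j _]; last first.
  have nj : (n - j = (n - j.+1).+1)%N by have := ltn_ord j; lia.
  rewrite /bump /= add0n add1n subSS /f nj /= [LHS]mxE.
  under eq_bigr => c _ do rewrite !mxE mulrCA.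
  rewrite -mulr_sumr (reindex_inj rev_ord_inj) /=.
  under eq_bigr => c _ do rewrite rev_ordK [X in _ * X]two_pointC.
  by rewrite -two_point_split exprS; ring.
rewrite sumrN -(big_mkord xpredT (fun j => f j.+1 - f j)) telescope_sumr // /f.
rewrite subn0 subnn add0n expr0 mxE exprS [two_point (0%N, a) _]two_pointC.
by ring.
Qed.

(** * The divisor equation and the quantum differential equation *)

Variable h : 'I_r.+1.
Hypothesis hE : h = 1%N :> nat.

(** By dimension only the number of lines through two points survives. *)
Lemma two_point_prim a b :
  two_point (0%N, a) (0%N, b) = ((a == r :> nat) && (b == r :> nat))%:R * 'X.
Proof.
apply/polyP => d; rewrite coefMX -polyC_natr coefC.
case: d => [|[|d]] /=; first exact: two_point_deg0.
- case: andP => [[/eqP ar /eqP br]|nab].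
    have [-> ->] : a = ord_max /\ b = ord_max by split; apply: val_inj.
    rewrite coef_two_point -[RHS](GW0_line hI) -[T r]/(T (@ord_max r)).
    by rewrite bracket_T bracket_T1 msetD0.
  apply/eqP/contraT => /two_point_dim /= dimE; case: nab.
  by split; apply/eqP; have := ltn_ord a; have := ltn_ord b; lia.
- apply/eqP/contraT => /two_point_dim /=; have := ltn_ord a; have := ltn_ord b; nia.
Qed.

Lemma divisor_two_point d n a b : (0 < d)%N ->
  (three_point (0%N, h) (n, a) (0%N, b))`_d
    = d%:R * (two_point (n, a) (0%N, b))`_d
      + (if n is n'.+1 then
           \sum_(c < r.+1) (c == a.+1 :> nat)%:R * (two_point (n', c) (0%N, b))`_d
         else 0).
Proof.
move=> d0; rewrite coef_three_point.
have := GW0_divisor hI (d := d) (A := [mset (n, a); (0%N, b)]).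
rewrite d0 => /(_ isT); have -> : T 1 = T h :> chow r by rewrite hE.
rewrite bracket_T1 => ->; rewrite coef_two_point; congr (_ + _).
rewrite -[[mset (0%N, b)]]msetD0 !sum_mset1D big_mset0 addr0 msetD0.
rewrite msetD1K.
case: n => // n; have -> : (n.+1, a).1%:Z - 1 = n%:Z by rewrite /=; lia.
rewrite /=; apply: eq_bigr => c _; rewrite coef_two_point; congr (_ * _).
rewrite mxE (bigD1 a) //= !mxE eqxx mul1r big1 ?addr0 // => e ea.
by rewrite !mxE (negPf ea : _ == _ :> nat = false) mul0r.
Qed.

(** Degree 0 is the classical product, degree 1 reduces to lines through two points by the divisor
    equation, and dimension excludes higher degrees. *)
Lemma three_point_hyp a b :
  three_point (0%N, h) (0%N, rev_ord a) (0%N, b) = qhyp r b a.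
Proof.
rewrite mxE; apply/polyP => d; rewrite coefD coefMX -!polyC_natr !coefC.
case: d => [|d] /=.
  rewrite addr0 coef_three_point.
  have := GW0_deg0 hI (a := h) (b := rev_ord a) (c := b).
  rewrite !bracket_T /= msetD0 mset3_rev => ->; rewrite -1?ltnS ?ltn_ord ?hE //; last by lia.
  by congr (nat_of_bool _)%:R; have := ltn_ord a; have := ltn_ord b; rewrite /=; lia.
case: d => [|d] /=.
  rewrite divisor_two_point // addr0 mul1r two_point_prim coefMX -polyC_natr coefC /= add0r.
  congr (nat_of_bool _)%:R.
  by have := ltn_ord a; have := ltn_ord b; rewrite /=; lia.
rewrite addr0; apply/eqP/contraT => /three_point_dim /=; rewrite hE.
by have := ltn_ord a; have := ltn_ord b; nia.
Qed.

(** [<< T_1 tau_(n+1)(T_a) T_b >>] is computed by the recursion relation and by the divisor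
    equation, the dimension constraint replacing the factor [(r + 1) d]. *)
Lemma two_point_qde n a b :
  r.+1%:R * \sum_(e < r.+1) two_point (n, a) (0%N, e) * qhyp r b e
    = (n%:R + 2 + a%:R + b%:R - r%:R)%:P * two_point (n.+1, a) (0%N, b)
      + r.+1%:R * \sum_(c < r.+1) (c == a.+1 :> nat)%:R * two_point (n, c) (0%N, b).
Proof.
transitivity (r.+1%:R * three_point (0%N, h) (n.+1, a) (0%N, b)).
  congr (_ * _); rewrite three_pointC three_point_trr; apply: eq_bigr => e _.
  by rewrite -three_point_hyp three_pointC.
apply/polyP => d; rewrite -!polyC_natr coefD !coefCM coef_sum.
under eq_bigr => c _ do rewrite -polyC_natr coefCM.
have [->|d0] := posnP d.
  rewrite three_pointC three_point_desc_deg0 two_point_deg0 !mulr0 add0r big1 ?mulr0 //.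
  by move=> c _; rewrite two_point_deg0 mulr0.
rewrite divisor_two_point // mulrDr mulrA; congr (_ + _).
have [->|nz] := eqVneq (two_point (n.+1, a) (0%N, b))`_d 0; first by rewrite !mulr0.
have := two_point_dim nz => /= /(congr1 (intr : int -> rat)).
rewrite !(intrD, intrM, intrB) /= => dimE; congr (_ * _).
apply: (addIr r%:R); rewrite subrK; apply: (etrans dimE).
by rewrite -pmulrn -[n.+1]addn1 natrD; ring.
Qed.

(** The quantum differential equation in matrix form. The levels enter only through the difference
    [a - b - j.+1], whence the validity for every [N]. *)
Lemma fund_inv_flat (N : int) (j : nat) :
  fund_inv j *m map_mx polyC (Rc1 r) + fund_inv j.+1 *m level_mx r (N - j.+1%:Z)
    = (r.+1%:R *: qhyp r) *m fund_inv j + level_mx r N *m fund_inv j.+1.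
Proof.
have Rc1E c a : map_mx polyC (Rc1 r) c a = r.+1%:R * (a == c.+1 :> nat)%:R.
  by rewrite !mxE rmorphM !rmorph_nat.
apply/matrixP => b a; rewrite [LHS]mxE [RHS]mxE.
have -> A m : (A *m level_mx r m) b a = A b a * (level r m a)%:P.
  by rewrite mul_mx_diag !mxE.
have -> A m : (level_mx r m *m A) b a = (level r m b)%:P * A b a.
  by rewrite mul_diag_mx !mxE.
suff qde : ((r.+1%:R *: qhyp r) *m fund_inv j) b a
    = (fund_inv j *m map_mx polyC (Rc1 r)) b a
      + (a%:R - b%:R - j.+1%:R)%:P * fund_inv j.+1 b a.
  rewrite qde -addrA [_%:P * _ + _]addrC -mulrDl -polyCD.
  by congr (_ + _); rewrite mulrC /level intrB -pmulrn; congr (polyC _ * _); ring.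
case: j => [|n].
  rewrite mulmx1 mul1mx Rc1E !mxE two_point_prim mulrDr; congr (_ + _).
  have -> : (rev_ord a == r :> nat) = (a == 0 :> nat).
    by apply/eqP/eqP; have := ltn_ord a; rewrite /=; lia.
  rewrite andbC; case: andP => [[/eqP -> /eqP ->]|_]; last by rewrite !mul0r !mulr0.
  by rewrite !mul1r -[r.+1]addn1 natrD !rmorphB /= polyC_natr; ring.
rewrite -scalemxAl mxE mxE.
transitivity ((-1) ^+ n.+1 * (r.+1%:R
    * \sum_(e < r.+1) two_point (n, rev_ord a) (0%N, e) * qhyp r b e)).
  rewrite mulrCA; congr (_ * _); rewrite mulr_sumr; apply: eq_bigr => e _.
  by rewrite fund_invS; ring.
rewrite two_point_qde mulrDr addrC; congr (_ + _); last first.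
  rewrite fund_invS.
  have -> : (rev_ord a : nat)%:R = r%:R - a%:R :> rat.
    by rewrite /= subSS natrB // -ltnS.
  have -> : n%:R + 2 + (r%:R - a%:R) + b%:R - r%:R
      = - (a%:R - b%:R - n.+2%:R) :> rat by rewrite -[n.+2]addn2 natrD; ring.
  by move: (_ - n.+2%:R) => x; rewrite polyCN [(-1) ^+ n.+2]exprS; ring.
rewrite mulrCA mulr_sumr mxE mulr_sumr (reindex_inj rev_ord_inj).
apply: eq_bigr => c _; rewrite Rc1E fund_invS.
have -> : (rev_ord c == (rev_ord a).+1 :> nat) = (a == c.+1 :> nat).
  by apply/eqP/eqP; have := ltn_ord a; have := ltn_ord c; rewrite /=; lia.
by ring.
Qed.

End GenusZero.

(** * Differences of the two families of invariants *)

Lemma size_msetD (K : choiceType) (A B : {mset K}) :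
  size (A `+` B) = (size A + size B)%N.
Proof.
rewrite -size_cat; apply: perm_size; apply/allP => x _ /=.
by rewrite count_cat !count_mem_mset msetE2.
Qed.

Lemma proper_submons_size (K : choiceType) (A B : {mset K}) :
  A `<=` B -> A != B -> (size A < size B)%N.
Proof.
move=> sAB nAB; rewrite -(msetBDK sAB) size_msetD -[X in (X < _)%N]add0n ltn_add2r.
rewrite lt0n size_mset_eq0 msetB_eq0; apply: contra nAB => sBA.
by rewrite eqEmsubset sAB.
Qed.

Lemma uniq_submons r (mu : mon r) : uniq (submons mu).
Proof. exact: undup_uniq. Qed.

(** Linearization: the coefficient of [G] at [mu] meets only [F mset0], and all other terms
    agree. *)
Lemma mul_series_subr r (F F' G G' : series r) (mu : mon r) e :
  (forall nu d, F nu d = F' nu d) ->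
  (forall nu d, nu `<=` mu -> nu != mu -> G nu d = G' nu d) ->
  mul_series F G mu e - mul_series F' G' mu e
    = \sum_(d < e.+1) F mset0 d * (G mu (e - d)%N - G' mu (e - d)%N).
Proof.
move=> eqF eqG; rewrite /mul_series -sumrB.
rewrite (bigD1_seq mset0) ?uniq_submons ?mem_submons ?msub0set //= !msetB0 -sumrB.
rewrite [X in _ + X]big_seq_cond [X in _ + X]big1 ?addr0 => [|nu].
  by apply: eq_bigr => d _; rewrite -eqF mulrBr.
rewrite mem_submons => /andP[sub_nu nu0].
apply/eqP; rewrite subr_eq0; apply/eqP; apply: eq_bigr => d _.
rewrite eqF eqG ?msubsetDl //; apply: contra nu0 => /eqP mu_nu.
by rewrite -(msetBBK sub_nu) mu_nu msetBxx.
Qed.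

Lemma mul_series_subl r (F F' G G' : series r) (mu : mon r) e :
  (forall nu d, G nu d = G' nu d) ->
  (forall nu d, nu `<=` mu -> nu != mu -> F nu d = F' nu d) ->
  mul_series F G mu e - mul_series F' G' mu e
    = \sum_(d < e.+1) (F mu d - F' mu d) * G mset0 (e - d)%N.
Proof.
move=> eqG eqF; rewrite /mul_series -sumrB.
rewrite (bigD1_seq mu) ?uniq_submons ?mem_submons ?msubset_refl //= msetBxx -sumrB.
rewrite [X in _ + X]big_seq_cond [X in _ + X]big1 ?addr0 => [|nu].
  by apply: eq_bigr => d _; rewrite -eqG mulrBl.
rewrite mem_submons => /andP[sub_nu nu_mu].
by apply/eqP; rewrite subr_eq0; apply/eqP; apply: eq_bigr => d _; rewrite eqF ?eqG.
Qed.

Lemma eq_mul_series r (F F' G G' : series r) (mu : mon r) e :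
  (forall nu d, nu `<=` mu -> F nu d = F' nu d) ->
  (forall nu d, nu `<=` mu -> G nu d = G' nu d) ->
  mul_series F G mu e = mul_series F' G' mu e.
Proof.
move=> eqF eqG; apply: eq_big_seq => nu; rewrite mem_submons => sub_nu.
by apply: eq_bigr => d _; rewrite eqF ?eqG ?msubsetDl.
Qed.

Lemma eq_corr r (I J : invariants r) g s (nu : mon r) d :
  (forall B : mon r, size B = (size s + size nu)%N -> I g d B = J g d B) ->
  corr I g s nu d = corr J g s nu d.
Proof.
move=> eqIJ; rewrite /corr; congr (_ / _).
elim: s nu eqIJ => [|[[m|m] gamma] s IH] nu eqIJ //=; first exact: eqIJ.
apply: eq_bigr => c _; congr (_ * _); apply: IH => B sizeB; apply: eqIJ.
by rewrite sizeB size_mset1D addnS.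
Qed.

Lemma eq_corr_up r (I J : invariants r) i m gamma1 gamma2 (nu : mon r) d :
  (forall d (B : mon r), (0 < size B)%N -> I 0 d B = J 0 d B) ->
  corr_up I i m gamma1 gamma2 nu d = corr_up J i m gamma1 gamma2 nu d.
Proof.
move=> eqIJ; elim: i m gamma1 gamma2 nu d => [|i IH] m gamma1 gamma2 nu d /=.
  by apply: eq_corr => B sizeB; rewrite eqIJ // sizeB.
rewrite IH; congr (_ - _); apply: eq_bigr => a _.
apply: eq_mul_series => // nu' d' _.
by apply: eq_corr => B sizeB; rewrite eqIJ // sizeB.
Qed.

Fixpoint up_mx r (I : invariants r) (i m : nat) : 'M[{poly rat}]_r.+1 :=
  if i is i'.+1 then up_mx I i' m.+1 - fund I m.+1 *m up_mx I i' 0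
  else fund I m.+1.

Lemma corr_up_mset0 r (I : invariants r) (hI : GW_invariants I) i m
    (a b : 'I_r.+1) d :
  corr_up I i m (T a) (T b) mset0 d = (up_mx I i m a (rev_ord b))`_d.
Proof.
have corr2 k (c c' : 'I_r.+1) d' :
    corr I 0 [:: (k%:Z, T c); (0, T c')] mset0 d'
      = (fund I k.+1 c (rev_ord c'))`_d'.
  rewrite corr_mset0 bracket_T bracket_T1 msetD0 mxE rev_ordK coef_two_point //.
  by rewrite msetDC.
elim: i m a b d => [|i IH] m a b d; first exact: corr2.
rewrite [LHS]/= [up_mx _ _ _]/= !mxE coefB IH; congr (_ - _).
rewrite coef_sum (reindex_inj rev_ord_inj); apply: eq_bigr => e _.
rewrite mul_series_mset0 coefM; apply: eq_bigr => j _.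
rewrite corr2 -[(r - _)%N]/(rev_ord (rev_ord e) : nat) IH.
by rewrite !rev_ordK.
Qed.

(** Replacing [j] by [k - j] turns each factor at [z] into minus a factor of the original product at
    [-z]. *)
Lemma brk_reflect (x : rat) (k p : nat) :
  brk (- x - k%:R) k p = (-1) ^+ (k.+1 + p) * brk x k p.
Proof.
rewrite /brk; set P := \prod_(j < k.+1) ('X + (x + j%:R)%:P).
have -> : \prod_(j < k.+1) ('X + (- x - k%:R + j%:R)%:P)
    = (-1) ^+ k.+1 * (P \Po (-1 *: 'X)).
  rewrite rmorph_prod -[k.+1 in X in _ ^+ X]card_ord -prodr_const -big_split /=.
  rewrite (reindex_inj rev_ord_inj); apply: eq_bigr => j _.
  rewrite comp_polyD comp_polyX comp_polyC mulN1r scaleN1r opprD opprK -polyCN.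
  congr (_ + polyC _); rewrite /= subSS natrB ?leq_ord //; ring.
have -> : (-1) ^+ k.+1 = ((-1) ^+ k.+1)%:P :> {poly rat}.
  by rewrite polyC_exp polyCN.
rewrite coefCM coef_comp_poly exprD -mulrA; congr (_ * _).
case: (ltnP p (size P)) => [lt_p|le_p].
  rewrite (bigD1 (Ordinal lt_p)) //= exprZn coefZ coefXn eqxx mulr1 mulrC.
  rewrite big1 ?addr0 // => i ip; rewrite exprZn coefZ coefXn eq_sym.
  by rewrite (negPf ip : _ == _ :> nat = false) !mulr0.
rewrite [P`_p]nth_default // mulr0 big1 // => i _; rewrite exprZn coefZ coefXn.
by rewrite gtn_eqF ?mulr0 // (leq_trans (ltn_ord i)).
Qed.

(** * One step of the recursion, at fixed genus [g.+1] and monomial [mu] *)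

Section Step.

Variables (r : nat) (I J : invariants r).
Hypothesis hI : GW_invariants I.
Hypothesis hJ : GW_invariants J.
Variables (g : nat) (mu : mon r).
Hypothesis agree : agree_below I J g.+1 (size mu).+1.

Definition one_point (j : nat) (a : 'I_r.+1) : {poly rat} :=
  gw_poly I 0 [mset (j, a)].

(** The functional [X] of the overview; the zero value at negative indices reflects [tau_l = 0] for
    [l < 0]. *)
Definition difference (z : int) : 'cV[{poly rat}]_r.+1 :=
  match z with
  | Posz j => \col_c (gw_poly I g.+1 ((j, c) +` mu)
                      - gw_poly J g.+1 ((j, c) +` mu))
  | Negz _ => 0
  end.

Let fact : rat := (\prod_(x <- finsupp mu) (mu x)`!)%N%:R.

Let fact_neq0 : fact != 0.
Proof.
rewrite pnatr_eq0 -lt0n prodn_gt0 // => x; exact: fact_gt0.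
Qed.

Let agree0 d (B : mon r) : (0 < size B)%N -> I 0 d B = J 0 d B.
Proof. by move=> B0; apply: agree. Qed.

Let eq_corr_low h s nu d : (h < g.+1)%N -> s != [::] ->
  corr I h s nu d = corr J h s nu d.
Proof.
move=> lt_hg s0; apply: eq_corr => B sizeB; apply: agree; rewrite ?lt_hg //.
by rewrite sizeB; case: s s0 {sizeB}.
Qed.

Let eq_corr_proper x nu d : nu `<=` mu -> nu != mu ->
  corr I g.+1 [:: x] nu d = corr J g.+1 [:: x] nu d.
Proof.
move=> sub_nu nu_mu; have := proper_submons_size sub_nu nu_mu => lt_nu.
by apply: eq_corr => B sizeB; apply: agree; rewrite sizeB // eqxx ltnn /= add1n ltnS.
Qed.

Let corr_sub z (b : 'I_r.+1) e :
  corr I g.+1 [:: (z, T b)] mu e - corr J g.+1 [:: (z, T b)] mu e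
    = (difference z b 0)`_e / fact.
Proof.
rewrite /corr -mulrBl; congr (_ / _); case: z => [j|j].
  by rewrite !bracket_T1 /= mxE coefB !coef_gw_poly.
by rewrite /= mxE coef0 subrr.
Qed.

(** Only products of a genus-0 factor at [t = 0] with a difference at [t^mu] survive. For [m = 0]
    these factors are [- fund_inv I i.+1] by [two_point_inverse]. *)
Lemma trr_difference : trr_eqs I g.+1 mu -> trr_eqs J g.+1 mu ->
  forall N : nat, (3 * g.+1 - 1 <= N)%N -> conv (fund_inv I) N.+1 difference N = 0.
Proof.
move=> trrI trrJ N le_N.
have upE i : up_mx I i 0 = - fund_inv I i.+1.
  apply: (two_point_inverse (S := fund I) (u := up_mx I)) => //.
  exact: fund_mul_inv.
suff XN : difference N = \sum_(i < N) up_mx I i 0 *m difference (N - 1 - i)%N.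
  rewrite /conv big_ord_recl mul1mx subr0 XN -big_split big1 //= => i _.
  have -> : N%:Z - (bump 0 i)%:Z = (N - 1 - i)%N%:Z.
    by rewrite /bump; have := ltn_ord i; lia.
  by rewrite upE mulNmx addNr.
apply/matrixP => c o; rewrite ord1 summxE; apply/polyP => e.
apply: (mulIf (invr_neq0 fact_neq0)); rewrite -corr_sub -[X in Posz X]addn0.
rewrite trrI // trrJ // -sumrB coef_sum mulr_suml; apply: eq_bigr => i _.
rewrite mxE coef_sum mulr_suml -sumrB (reindex_inj rev_ord_inj).
apply: eq_bigr => a _; rewrite mul_series_subr; first last.
- by move=> nu d; apply: eq_corr_proper.
- by move=> nu d; apply: eq_corr_up agree0.
rewrite coefM mulr_suml; apply: eq_bigr => d _.
rewrite corr_up_mset0 // rev_ordK -[(r - _)%N]/(rev_ord (rev_ord a) : nat).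
by rewrite rev_ordK corr_sub mulrA.
Qed.

Let corr_one_point j (a : 'I_r.+1) d :
  corr I 0 [:: (j%:Z, T a)] mset0 d = (one_point j a)`_d.
Proof. by rewrite corr_mset0 bracket_T1 msetD0 coef_gw_poly. Qed.

Let mul_series_one_point_corr z (i : nat) (a b : 'I_r.+1) e :
  mul_series (corr I 0 [:: (i%:Z, T a)]) (corr I g.+1 [:: (z, T b)]) mu e
    - mul_series (corr J 0 [:: (i%:Z, T a)]) (corr J g.+1 [:: (z, T b)]) mu e
    = (one_point i a * difference z b 0)`_e / fact.
Proof.
rewrite mul_series_subr; first last.
- by move=> nu d; apply: eq_corr_proper.
- by move=> nu d; apply: eq_corr_low.
rewrite coefM mulr_suml; apply: eq_bigr => d _.
by rewrite corr_one_point corr_sub mulrA.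
Qed.

Let mul_series_corr_one_point z (i : nat) (a b : 'I_r.+1) e :
  mul_series (corr I g.+1 [:: (z, T a)]) (corr I 0 [:: (i%:Z, T b)]) mu e
    - mul_series (corr J g.+1 [:: (z, T a)]) (corr J 0 [:: (i%:Z, T b)]) mu e
    = (difference z a 0 * one_point i b)`_e / fact.
Proof.
rewrite mul_series_subl; first last.
- by move=> nu d; apply: eq_corr_proper.
- by move=> nu d; apply: eq_corr_low.
rewrite coefM mulr_suml; apply: eq_bigr => d _.
by rewrite corr_one_point corr_sub mulrAC.
Qed.

Let vsign (k p i : nat) (a b : 'I_r.+1) : rat :=
  (-1) ^+ i.+1 * vcoef k p a (- i.+1%:Z) b.

(** Symmetry of the quadratic Virasoro terms under exchange of their two factors: the bracket
    argument [x] becomes [- x - k], and the sign from [brk_reflect] balances the change of [i]. *)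
Lemma vsign_reflect k p (i : 'I_(k - p)) a b :
  vsign k p (rev_ord i) (rev_ord b) (rev_ord a) = vsign k p i a b.
Proof.
rewrite /vsign /vcoef !Rc1_exp.
have -> : (rev_ord a == rev_ord b + p :> nat)%N = (b == a + p :> nat)%N.
  by apply/eqP/eqP; have := ltn_ord a; have := ltn_ord b; rewrite /=; lia.
case: eqP => [bE|_]; last by rewrite !mulr0.
rewrite !mulr1 !mulrA; congr (_ * _).
set x := a%:R + _ + _.
have -> : (rev_ord b)%:R + (- (rev_ord i).+1%:Z)%:~R + (1 - r%:R) / 2 = - x - k%:R.
  have /(congr1 (fun n => n%:R : rat)) : ((rev_ord i).+1 + i + p = k)%N.
    by have := ltn_ord i; rewrite /=; lia.
  have /(congr1 (fun n => n%:R : rat)) : (rev_ord b + a + p = r)%N.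
    by rewrite /=; have := ltn_ord b; lia.
  have negE n : (- n%:Z)%:~R = - n%:R :> rat by rewrite mulrNz -pmulrn.
  rewrite /x !negE !natrD -[i.+1]addn1 natrD => eqb eqi.
  by rewrite -[in RHS]eqi -eqb; field.
rewrite brk_reflect mulrA; congr (_ * _).
rewrite -exprD -[LHS]signr_odd -[RHS]signr_odd; congr (_ ^+ (nat_of_bool _)).
have /(congr1 odd) : ((rev_ord i).+1 + i + p = k)%N.
  by have := ltn_ord i; rewrite /=; lia.
by rewrite !oddD !oddS; case: (odd k); case: (odd _); case: (odd _); case: (odd _).
Qed.

Let vir0 (k : nat) : {poly rat} :=
  \sum_(p < k.+2) \sum_(b < r.+1) (brk ((3 - r%:R) / 2) k p * (Rc1 r ^+ p) ord0 b)%:P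
    * difference (k%:Z + 1 - p%:Z) b 0.

Let vir1 (k : nat) : {poly rat} :=
  \sum_(p < k.+2) \sum_(i < k - p) \sum_(a < r.+1) \sum_(b < r.+1)
    (vsign k p i a b)%:P
    * (one_point i (rev_ord a) * difference (rev_ord i) b 0).

(** Only the first sum and the two extreme genus splittings survive the subtraction; the splittings
    contribute equally, which absorbs the factor 1/2. *)
Lemma virasoro_sub k e :
  virasoro I k g.+1 mu e - virasoro J k g.+1 mu e = (vir1 k - vir0 k)`_e / fact.
Proof.
have comb (A B C D A' B' C' D' h : rat) :
    - A + B + h * C + h * D - (- A' + B' + h * C' + h * D')
      = - (A - A') + (B - B') + h * (C - C') + h * (D - D') by ring.
rewrite /virasoro /= comb.
(* Dropping a variable of [mu] leaves [size mu] marked points, where the invariants agree. *)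
rewrite [X in _ + X + _ + _](_ : _ = 0); last first.
  rewrite -sumrB big1 // => p _; rewrite -sumrB big_seq big1 // => x mu_x.
  rewrite -sumrB big1 // => b _; rewrite -mulrBr [X in _ * X](_ : _ = 0) ?mulr0 //.
  apply/eqP; rewrite subr_eq0; apply/eqP/eq_corr => B sizeB.
  apply: agree; rewrite sizeB // eqxx ltnn /= add1n ltnS -(size_mset1D x) msetB1K //.
  by rewrite -msuppE.
rewrite addr0 [X in _ + _ * X + _](_ : _ = 0); last first.
  rewrite -sumrB big1 // => p _; rewrite -sumrB big1 // => i _.
  rewrite -sumrB big1 // => a _; rewrite -sumrB big1 // => b _.
  by rewrite -mulrBr eq_corr_low ?subrr ?mulr0.
rewrite mulr0 addr0 [LHS]addrC coefB [RHS]mulrBl; congr (_ - _); last first.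
  rewrite -sumrB coef_sum mulr_suml; apply: eq_bigr => p _.
  rewrite -sumrB coef_sum mulr_suml; apply: eq_bigr => b _.
  by rewrite -mulrBr corr_sub coefCM mulrA.
suff -> : forall u v, u - v = 2 * ((vir1 k)`_e / fact) -> 2^-1 * (u - v) = (vir1 k)`_e / fact.
- by [].
- rewrite -sumrB coef_sum mulr_suml mulr_sumr; apply: eq_bigr => p _.
  pose F i a b := vsign k p i a b
    * ((one_point i (rev_ord a) * difference (k - p - i.+1)%N b 0)`_e / fact).
  (* The first double sum is the splitting [h = 0], the second is [h = g.+1]. *)
  transitivity (\sum_(i < k - p) (\sum_a \sum_b F i a b
      + \sum_a \sum_b F (rev_ord i) (rev_ord b) (rev_ord a))).
    rewrite -sumrB; apply: eq_bigr => i _.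
    have signE : (-1) ^ (- i.+1%:Z) = (-1) ^+ i.+1 :> rat.
      by rewrite -exprnN -exprVn invrN1.
    have iE : - - i.+1%:Z - 1 = i%:Z by lia.
    have riE : k%:Z + - i.+1%:Z - p%:Z = (rev_ord i)%:Z.
      by have := ltn_ord i; rewrite /=; lia.
    rewrite signE iE riE -sumrB big_ord_recl.
    rewrite [X in _ + X = _]big_ord_recr /= [X in _ + (X + _) = _]big1 => [|h _]; last first.
      (* An intermediate splitting has both genera below [g.+1]. *)
      have lt_h : (bump 0 h < g.+1)%N by rewrite /bump add1n ltnS.
      apply/eqP; rewrite subr_eq0; apply/eqP.
      apply: eq_bigr => a _; apply: eq_bigr => b _; congr (_ * _).
      apply: eq_mul_series => nu d _; apply: eq_corr_low => //.
      by rewrite /bump add1n subSS ltnS leq_subr.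
    rewrite add0r; congr (_ + _).
      rewrite -sumrB; apply: eq_bigr => a _; rewrite -sumrB; apply: eq_bigr => b _.
      rewrite -mulrBr subn0 -[(r - a)%N]/(rev_ord a : nat).
      by rewrite mul_series_one_point_corr.
    rewrite -sumrB; apply: eq_bigr => a _; rewrite -sumrB; apply: eq_bigr => b _.
    rewrite -mulrBr /bump /= add1n subnn -[(r - a)%N]/(rev_ord a : nat).
    rewrite mul_series_corr_one_point /F vsign_reflect rev_ordK.
    rewrite [one_point _ _ * _]mulrC; congr (_ * ((difference _ _ _ * _)`_e / _)).
    by have := ltn_ord i; rewrite /=; lia.
  rewrite big_split [X in _ + X = _](_ : _ = \sum_(i < k - p) \sum_a \sum_b F i a b).
    rewrite -[LHS]mulr2n -[LHS]mulr_natl; congr (_ * _).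
    rewrite coef_sum mulr_suml; apply: eq_bigr => i _.
    rewrite coef_sum mulr_suml; apply: eq_bigr => a _.
    rewrite coef_sum mulr_suml; apply: eq_bigr => b _.
    by rewrite /F coefCM mulrA.
  rewrite [RHS](reindex_inj rev_ord_inj) /=; apply: eq_bigr => i _.
  rewrite exchange_big [RHS](reindex_inj rev_ord_inj); apply: eq_bigr => b _.
  by rewrite [RHS](reindex_inj rev_ord_inj).
- by move=> u v ->; rewrite mulKf.
Qed.

(** The convolved iterate of order [k.+1] splits by powers of [1/z]: [G 0] is the linear Virasoro
    term, [G 1] vanishes, and the [G i.+2] sum to minus the quadratic terms. *)
Lemma virasoro_difference k : (1 <= k)%N ->
  virasoro_eqs I g.+1 mu -> virasoro_eqs J g.+1 mu ->
  conv (fund_inv I) k.+2 (iter k.+1 (dualop (map_mx polyC (Rc1 r))) difference) 0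
    ord0 ord0 = 0.
Proof.
move=> k1 virI virJ; have vir01 : vir0 k = vir1 k.
  apply/eqP; rewrite eq_sym -subr_eq0; apply/eqP/polyP => e.
  apply: (mulIf (invr_neq0 fact_neq0)).
  by rewrite -virasoro_sub -virI // -virJ // subrr coef0 mul0r.
have iterE j a : iter k.+1 (dualop (map_mx polyC (Rc1 r))) difference (- j%:Z) a 0
    = \sum_(p < k.+2) \sum_(b < r.+1)
        (brk (level r (- j%:Z) a) k p * (Rc1 r ^+ p) a b)%:P
        * difference (- j%:Z + k.+1%:Z - p%:Z) b 0.
  exact: iter_classical.
move: (iter _ _ _) iterE => Z iterE.
pose G j := \sum_a fund_inv I j ord0 a * Z (- j%:Z) a 0.
pose H p i := \sum_a \sum_b (vsign k p i a b)%:P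
  * (one_point i (rev_ord a) * difference (k - p - i.+1)%N b 0).
have G0 : G 0 = vir0 k.
  transitivity ((1%:M *m Z (- 0%N%:Z)) ord0 0); first by rewrite mxE.
  rewrite mul1mx iterE; apply: eq_bigr => p _; apply: eq_bigr => b _.
  congr (_ * difference _ _ _); last by lia.
  by rewrite /level addr0 oppr0 mulr0z add0r.
have G1 : G 1 = 0.
  apply: big1 => a _; rewrite fund_invS.
  have -> : two_point I (0%N, rev_ord a) (0%N, ord0) = 0.
    by apply/polyP => d; rewrite string_one_point // coef0.
  by rewrite mulr0 mul0r.
have GS i : G i.+2 = \sum_(p < k.+2) if (i < k - p)%N then - H p i else 0.
  rewrite /G; under eq_bigr => a _ do rewrite iterE mulr_sumr.
  rewrite exchange_big; apply: eq_bigr => p _.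
  (* For [i >= k - p] the index [k - p - i.+1] is negative, where [difference] is zero. *)
  case: ifP => lt_i; last first.
    apply: big1 => a _; apply/eqP; rewrite mulf_eq0; apply/orP; right; apply/eqP.
    apply: big1 => b _; have [l ->] : exists l, - i.+2%:Z + k.+1%:Z - p%:Z = Negz l.
      by exists (i + p - k)%N; rewrite NegzE; lia.
    by rewrite mxE mulr0.
  rewrite /H -sumrN; apply: eq_bigr => a _; rewrite mulr_sumr -sumrN.
  apply: eq_bigr => b _; rewrite fund_invS.
  have -> : two_point I (i.+1, rev_ord a) (0%N, ord0) = one_point i (rev_ord a).
    by apply/polyP => d; rewrite string_one_point // coef_gw_poly.
  have -> : - i.+2%:Z + k.+1%:Z - p%:Z = (k - p - i.+1)%N by lia.
  (* Passing from [i.+2] to [i.+1] turns the offset [(3 - r) / 2] into [(1 - r) / 2]. *)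
  have -> : level r (- i.+2%:Z) a = a%:R + (- i.+1%:Z)%:~R + (1 - r%:R) / 2.
    by rewrite /level !mulrNz -!pmulrn -[i.+2]addn1 natrD; field.
  rewrite -[brk _ _ _ * _]/(vcoef k p a (- i.+1%:Z) b) /vsign.
  rewrite [((-1) ^+ _ * _)%:P]polyCM polyC_exp polyCN.
  by rewrite [(-1) ^+ i.+2]exprS; ring.
transitivity (G 0 + (G 1 + \sum_(i < k) G i.+2)).
  transitivity (\sum_(j < k.+2) G j); last by rewrite 2!big_ord_recl.
  by rewrite summxE; apply: eq_bigr => j _; rewrite mxE sub0r.
rewrite G0 G1 add0r vir01 (eq_bigr _ (fun (i : 'I_k) _ => GS i)) exchange_big -big_split.
apply: big1 => p _ /=.
rewrite -big_mkcond sumrN -[X in X + _]/(\sum_(i < k - p) H p i).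
by rewrite (big_ord_widen k (H p)) ?leq_subr // subrr.
Qed.

Lemma difference_eq0 (hr : (1 <= r)%N) :
  virasoro_eqs I g.+1 mu -> trr_eqs I g.+1 mu ->
  virasoro_eqs J g.+1 mu -> trr_eqs J g.+1 mu ->
  forall N : nat, difference N = 0.
Proof.
move=> virI trrI virJ trrJ.
apply: (dual_sequence_eq0 (Q := fund_inv I)) => //.
(* As [1 <= r], [inord 1] is the index of the hyperplane class. *)
- by apply: (@fund_inv_flat r I hI (inord 1)); rewrite inordK.
- by case.
- exact: trr_difference.
(* The iterate of order [k.+2] comes from the Virasoro condition of index [k.+1]. *)
- by case=> [|[|k]] // _; apply: virasoro_difference.
Qed.

End Step.

(** * Induction over the genus, then over the number of marked points *)

Theorem theorem2p1 (r : nat) (hr : (1 <= r)%N) (I J : invariants r)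
    (hI : GW_invariants I) (hJ : GW_invariants J) :
  (* one step of the recursion: the linear equations at t^mu have at most one
     solution once the lower invariants are given *)
  (forall (g n : nat) (mu : mon r), (1 <= g)%N -> (1 <= n)%N ->
     size mu = (n - 1)%N ->
     agree_below I J g n ->
     virasoro_eqs I g mu -> trr_eqs I g mu ->
     virasoro_eqs J g mu -> trr_eqs J g mu ->
     forall (j : nat) (b : 'I_r.+1) (e : nat),
       I g e ((j, b) +` mu) = J g e ((j, b) +` mu))
  /\
  (* the recursion determines all pointed invariants of genus at least 1 *)
  ((forall (d : nat) (A : mon r), I 0%N d A = J 0%N d A) ->
   (forall (g : nat) (mu : mon r), (1 <= g)%N ->
      virasoro_eqs I g mu /\ trr_eqs I g mu) ->
   (forall (g : nat) (mu : mon r), (1 <= g)%N ->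
      virasoro_eqs J g mu /\ trr_eqs J g mu) ->
   forall (g d : nat) (A : mon r), (1 <= g)%N -> (1 <= size A)%N ->
     I g d A = J g d A).
Proof.
have step g n (mu : mon r) : (1 <= g)%N -> (1 <= n)%N -> size mu = (n - 1)%N ->
     agree_below I J g n ->
     virasoro_eqs I g mu -> trr_eqs I g mu ->
     virasoro_eqs J g mu -> trr_eqs J g mu ->
     forall (j : nat) (b : 'I_r.+1) (e : nat),
       I g e ((j, b) +` mu) = J g e ((j, b) +` mu).
  case: g => // g _; case: n => // n _; rewrite subn1 /= => size_mu.
  rewrite -size_mu => agree virI trrI virJ trrJ j b e.
  have := difference_eq0 hI hJ agree hr virI trrI virJ trrJ j.
  move/matrixP/(_ b 0); rewrite !mxE => /(congr1 (fun p : {poly rat} => p`_e)).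
  by rewrite coefB !coef_gw_poly // coef0 => /eqP; rewrite subr_eq0 => /eqP.
split=> // eq0 eqsI eqsJ g; elim/ltn_ind: g => g IHg d A g1.
have [n] := ubnP (size A); elim: n d A => // n IHn d A lt_A A1.
case: (mset_0Vmem A) => [A0|[[j b] Ab]]; first by rewrite A0 size_mset0 in A1.
(* One insertion is singled out as the varying one; the others form the monomial at which the
   equations are read. *)
have AE : A = (j, b) +` (A `\ (j, b)) by rewrite msetB1K.
have sizeA : size A = (size (A `\ (j, b))).+1 by rewrite {1}AE size_mset1D.
have [virI trrI] := eqsI g (A `\ (j, b)) g1.
have [virJ trrJ] := eqsJ g (A `\ (j, b)) g1.
rewrite AE; apply: (step g (size A)) => //; first by rewrite sizeA subn1.
move=> h d' B B1 /orP[lt_hg|/andP[/eqP -> lt_BA]].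
  by case: h lt_hg => [|h] lt_hg; [exact: eq0 | apply: IHg].
by apply: IHn => //; rewrite (leq_trans lt_BA) // -ltnS.
Qed.
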